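(* The semigroup $\mathrm{End}^1(\boldsymbol{B}_{\omega})$ (under composition of maps) of all monoid endomorphisms of the bicyclic monoid $\boldsymbol{B}_{\omega}$ is isomorphic to the semigroup $(\omega,* )$.
   Context: $\omega$ is the set of non-negative integers and $(\omega,* )$ is the multiplicative semigroup of non-negative integers. The bicyclic monoid is realized as $\boldsymbol{B}_{\omega}=\omega\times\omega$ with operation $(i_1,j_1)\cdot(i_2,j_2)=(i_1+i_2-\min\{j_1,i_2\},\;j_1+j_2-\min\{j_1,i_2\})$ and identity $(0,0)$. A monoid endomorphism is a multiplicative self-map that fixes the identity $(0,0)$. *)

(* Defs.v *)
From HB Require Import structures.
From mathcomp Require Import all_boot.
From mathcomp Require Import boolp.
From mathcomp Require Import zify.
Import Algebra.

Set Implicit Arguments.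
Unset Strict Implicit.
Unset Printing Implicit Defensive.

Local Open Scope group_scope.

(* An alias, so that the bicyclic product does not compete with the           *)
(* componentwise structures on [nat * nat].                                   *)
Definition bicyclic : Type := (nat * nat)%type.

HB.instance Definition _ := Choice.on bicyclic.

Definition bicyclic_mul (x y : bicyclic) : bicyclic :=
  ((x.1 + y.1 - minn x.2 y.1)%N, (x.2 + y.2 - minn x.2 y.1)%N).

Definition bicyclic_one : bicyclic := (0%N, 0%N).

Lemma bicyclic_mulA : associative bicyclic_mul.
Proof.
by move=> [a b] [c d] [e f]; rewrite /bicyclic_mul /=; congr pair; lia.
Qed.

Lemma bicyclic_mul1 : left_id bicyclic_one bicyclic_mul.
Proof. by move=> [a b]; rewrite /bicyclic_mul /=; congr pair; lia. Qed.

Lemma bicyclic_mulr1 : right_id bicyclic_one bicyclic_mul.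
Proof. by move=> [a b]; rewrite /bicyclic_mul /=; congr pair; lia. Qed.

HB.instance Definition _ :=
  isMonoid.Build bicyclic bicyclic_mulA bicyclic_mul1 bicyclic_mulr1.

Definition endo1 (M : monoidType) : Type := UMagmaMorphism.type M M.

Section EndoSemigroup.
Variable M : monoidType.

Definition endo1_comp (f g : endo1 M) : endo1 M := f \o g.

Lemma endo1_ext (f g : endo1 M) : f =1 g -> f = g.
Proof.
case: f g => [f [[fM] [f1]]] [g [[gM] [g1]]] /= /funext efg.
subst g; rewrite (Prop_irrelevance gM fM).
by rewrite (Prop_irrelevance g1 f1).
Qed.

Lemma endo1_compA : associative endo1_comp.
Proof. by move=> f g h; apply: endo1_ext. Qed.

(* [semigroupType] requires a [choiceType] carrier; on a type of functions    *)
(* this structure comes from classical choice.                                *)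
HB.instance Definition _ := gen_eqMixin (endo1 M).
HB.instance Definition _ := gen_choiceMixin (endo1 M).
HB.instance Definition _ := isSemigroup.Build (endo1 M) endo1_compA.

End EndoSemigroup.

(* An alias carrying the multiplicative semigroup structure of [nat].         *)
Definition mulnat : Type := nat.

HB.instance Definition _ := Choice.on mulnat.
HB.instance Definition _ := isSemigroup.Build mulnat mulnA.

Definition semigroup_isomorphic (S T : semigroupType) : Prop :=
  exists f : {multiplicative S -> T}, bijective f.

(* Main.v *)
(* The bicyclic monoid is generated by q = (1, 0) and p = (0, 1), with
   p q = 1 and (i, j) = q^i p^j.  An endomorphism f satisfies f(p) f(q) = 1,
   and a product (a, b)(c, d) is 1 only if a = d = 0 and b = c; hence
   f(q) = (k, 0) and f(p) = (0, k) for some k, that is, f(i, j) = (k i, k j).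
   Conversely each such map is an endomorphism, since multiplication by k
   distributes over +, - and min; composition multiplies the factors k. *)
From HB Require Import structures.
Require Import Defs.
From mathcomp Require Import all_boot.
From mathcomp Require Import zify.
Import Algebra.

Local Open Scope group_scope.

Lemma bicyclic_mulE (x y : bicyclic) : x * y = bicyclic_mul x y.
Proof. by []. Qed.

Definition bicyclic_scale (k : nat) (x : bicyclic) : bicyclic :=
  ((k * x.1)%N, (k * x.2)%N).

Lemma bicyclic_scaleM k : {morph bicyclic_scale k : x y / x * y}.
Proof.
move=> [a b] [c d]; rewrite !bicyclic_mulE /bicyclic_scale /bicyclic_mul /=.
by rewrite !mulnBr !mulnDr minnMr.
Qed.

Lemma bicyclic_scale1 k : bicyclic_scale k 1 = 1.
Proof. by rewrite /bicyclic_scale /= muln0. Qed.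

HB.instance Definition _ k :=
  isMultiplicative.Build bicyclic bicyclic (bicyclic_scale k)
    (bicyclic_scaleM k).
HB.instance Definition _ k :=
  Multiplicative_isUMagmaMorphism.Build bicyclic bicyclic (bicyclic_scale k)
    (bicyclic_scale1 k).

Definition bicyclic_q : bicyclic := (1%N, 0%N).
Definition bicyclic_p : bicyclic := (0%N, 1%N).

Lemma bicyclic_pq : bicyclic_p * bicyclic_q = 1.
Proof. by []. Qed.

Lemma bicyclic_Xl k n : ((k, 0%N) : bicyclic) ^+ n = ((k * n)%N, 0%N).
Proof.
elim: n => [|n IHn]; first by rewrite muln0.
by rewrite expgS IHn bicyclic_mulE /bicyclic_mul /= min0n !subn0 mulnS.
Qed.

Lemma bicyclic_Xr k n : ((0%N, k) : bicyclic) ^+ n = (0%N, (k * n)%N).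
Proof.
elim: n => [|n IHn]; first by rewrite muln0.
by rewrite expgS IHn bicyclic_mulE /bicyclic_mul /= minn0 !subn0 mulnS.
Qed.

Lemma bicyclic_qpE (i j : nat) :
  ((i, j) : bicyclic) = bicyclic_q ^+ i * bicyclic_p ^+ j.
Proof.
by rewrite bicyclic_Xl bicyclic_Xr bicyclic_mulE /bicyclic_mul /= min0n !subn0
           !mul1n addn0.
Qed.

(** Since [minn x.2 y.1] exceeds neither argument, a zero first coordinate forces [x.1 = 0] and
    [y.1 <= x.2]; a zero second one forces [y.2 = 0] and [x.2 <= y.1]. *)
Lemma bicyclic_mul_eq1 (x y : bicyclic) :
  x * y = 1 -> [/\ x.1 = 0%N, y.2 = 0%N & x.2 = y.1].
Proof.
case: x y => [a b] [c d]; rewrite bicyclic_mulE => -[/= e1 e2].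
by split; lia.
Qed.

Definition endo1_factor (f : endo1 bicyclic) : mulnat := (f bicyclic_q).1.

Lemma endo1_scaleE (f : endo1 bicyclic) :
  f =1 bicyclic_scale (endo1_factor f).
Proof.
have /bicyclic_mul_eq1[] : f bicyclic_p * f bicyclic_q = 1.
  by rewrite -gmulfM bicyclic_pq gmulf1.
case fp: (f bicyclic_p) => [a b]; case fq: (f bicyclic_q) => [c d] /=.
move=> a0 d0 bc; subst a d b; case=> i j.
(* Now [fp] and [fq] give the images [(0, c)] and [(c, 0)], with [c] the factor of [f]. *)
rewrite bicyclic_qpE gmulfM !gmulfXn fp fq /endo1_factor fq.
rewrite !bicyclic_Xl !bicyclic_Xr !bicyclic_mulE /bicyclic_mul /bicyclic_scale.
by rewrite /= !min0n !subn0 !addn0 !mul1n.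
Qed.

Lemma endo1_factorM : {morph endo1_factor : f g / f * g}.
Proof.
move=> f g; rewrite {1}/endo1_factor.
(* The product is composition by definition, and [f] scales the first coordinate of
   [g bicyclic_q]. *)
rewrite -[(f * g) bicyclic_q]/(f (g bicyclic_q)).
by rewrite endo1_scaleE.
Qed.

HB.instance Definition _ :=
  isMultiplicative.Build (endo1 bicyclic) mulnat endo1_factor endo1_factorM.

Theorem mainTheorem3 : semigroup_isomorphic (endo1 bicyclic) mulnat.
Proof.
exists endo1_factor.
exists (fun k : mulnat => bicyclic_scale k : endo1 bicyclic).
- by move=> f; apply: endo1_ext => x; rewrite [RHS]endo1_scaleE.
(* The factor is read off at [(1, 0)], so it computes to [k * 1]. *)
- by move=> k; apply: muln1.
Qed.
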